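(* Let $p_0\in(0,1)$ and let $G$ be a probability distribution on $[0,1]$ that has no atom at $1$ and has a density $g$ with $g(\alpha)\sim c\,(1-\alpha)^{b-1}$ as $\alpha\uparrow 1$, for some constants $b,c>0$. Let $m_k=\mathbb{E}_{\alpha\sim G}[\alpha^k]$ and $r_k=\frac{p_0}{p_0+(1-p_0)m_k}$ for integers $k\ge0$. Then, as $k\to\infty$, $$m_k\sim c\,\Gamma(b)\,k^{-b},\qquad 1-r_k\sim\kappa\,k^{-b},\qquad \kappa=\frac{1-p_0}{p_0}\,c\,\Gamma(b).$$ In particular, for $G=\mathrm{Beta}(a,b)$ with $a,b>0$ one has exactly, for every integer $k\ge 0$, $$m_k=\frac{(a)_k}{(a+b)_k}=\prod_{j=0}^{k-1}\frac{a+j}{a+b+j},$$ and $c\,\Gamma(b)=\frac{\Gamma(a+b)}{\Gamma(a)}$.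
   Context: $(x)_k=x(x+1)\cdots(x+k-1)$ is the rising factorial, with $(x)_0=1$. The notation $u\sim v$ for functions or sequences means $u/v\to1$. Interpretation: $r_k$ is the probability that a candidate answer is correct given that $k$ verification gates all accepted it, where $p_0$ is the prior probability of correctness, correct answers are always accepted, and erroneous answers have a latent false-accept rate $\alpha\sim G$ given which gate verdicts are i.i.d. Bernoulli$(\alpha)$. *)

(* Defs.v *)
From HB Require Import structures.
From mathcomp Require Import all_boot all_order all_algebra.
From mathcomp Require Import all_classical all_reals all_analysis.
From mathcomp Require Import measurable_realfun ftc.
From mathcomp Require Import ring lra.

Set Implicit Arguments.
Unset Strict Implicit.
Unset Printing Implicit Defensive.

Import Order.TTheory GRing.Theory Num.Theory.
Import numFieldNormedType.Exports.

Local Open Scope classical_set_scope.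
Local Open Scope ring_scope.

Definition asymp_equiv (R : realType) (T : Type) (F : set_system T)
    (u v : T -> R) : Prop :=
  (fun x => u x / v x) @ F --> (1 : R).

Definition rising_fact (R : realType) (x : R) (k : nat) : R :=
  \prod_(j < k) (x + j%:R).

Definition Gamma (R : realType) (s : R) : R :=
  \int[lebesgue_measure]_(t in `]0, +oo[) (t `^ (s - 1) * expR (- t)).

Definition has_density (R : realType)
    (G : probability (measurableTypeR R) R) (g : R -> R) : Prop :=
  [/\ measurable_fun [set: R] g,
      forall x, 0 <= g x &
      forall A : set R, measurable A ->
        G A = (\int[lebesgue_measure]_(x in A) (g x)%:E)%E].

Definition power_edge_law (R : realType)
    (G : probability (measurableTypeR R) R) (g : R -> R) (b c : R) : Prop :=
  [/\ G `[0, 1]%classic = 1%E,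
      G [set 1] = 0%E,
      has_density G g &
      asymp_equiv (1 : R)^'- g (fun x => c * (1 - x) `^ (b - 1))].

Definition moment (R : realType) (G : probability (measurableTypeR R) R)
    (k : nat) : R :=
  fine ('E_G[(fun x : R => x ^+ k)%R])%E.

Definition posterior (R : realType) (p0 : R)
    (G : probability (measurableTypeR R) R) (k : nat) : R :=
  p0 / (p0 + (1 - p0) * moment G k).

(* The Beta law with positive real parameters; the library's [beta_prob] only
   covers natural ones. *)
Definition Beta_weight (R : realType) (a b : R) (x : R) : R :=
  x `^ (a - 1) * (1 - x) `^ (b - 1).

Definition Beta_fun (R : realType) (a b : R) : R :=
  \int[lebesgue_measure]_(x in `]0, 1[) Beta_weight a b x.

Definition Beta_pdf (R : realType) (a b : R) : R -> R :=
  (fun x => Beta_weight a b x / Beta_fun a b) \_ `]0, 1[.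

Section Beta_fun.
Context (R : realType).
Implicit Types a b x : R.
Local Notation mu := (@lebesgue_measure R).

Lemma Beta_weight_ge0 a b x : 0 <= Beta_weight a b x.
Proof. by rewrite mulr_ge0 ?powR_ge0. Qed.

Lemma measurable_onem_powR b :
  measurable_fun [set: R] (fun x : R => (1 - x) `^ b).
Proof.
apply: (@measurableT_comp _ _ _ _ _ _ (@powR R ^~ b)).
  exact: measurable_powR.
exact: measurable_funB.
Qed.

Lemma measurable_Beta_weight a b : measurable_fun [set: R] (Beta_weight a b).
Proof.
apply: measurable_funM; first exact: measurable_powR.
exact: measurable_onem_powR.
Qed.

Let sing a b x : R := x `^ (a - 1) + (1 - x) `^ (b - 1).
Let prim a b x : R := a^-1 * x `^ a - b^-1 * (1 - x) `^ b.

Let sing_ge0 a b x : 0 <= sing a b x.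
Proof. by rewrite addr_ge0 ?powR_ge0. Qed.

Let measurable_sing a b : measurable_fun [set: R] (sing a b).
Proof.
apply: measurable_funD; first exact: measurable_powR.
exact: measurable_onem_powR.
Qed.

Let powR_le1 x a : 0 < x < 1 -> 0 < a -> x `^ a <= 1.
Proof.
move=> /andP[x0 x1] a0; have := @ge0_ler_powR R a (ltW a0) x 1.
by rewrite powR1; apply; rewrite ?nnegrE ?ltW.
Qed.

Let weight_le_sing a b x : 0 < a -> 0 < b -> 0 < x < 1 ->
  Beta_weight a b x <= sing a b x.
Proof.
move=> a0 b0 x01; have /andP[x0 x1] := x01.
have y0 : 0 < 1 - x by rewrite subr_gt0.
have y01 : 0 < 1 - x < 1 by rewrite y0 ltrBlDr ltrDl.
have -> : Beta_weight a b x =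
    x `^ a * (1 - x) `^ (b - 1) + x `^ (a - 1) * (1 - x) `^ b.
  rewrite -(mulr_powRB1 (ltW x0) a0) -(mulr_powRB1 (ltW y0) b0) /Beta_weight.
  by ring.
rewrite /sing addrC lerD//.
  by rewrite ler_piMr ?powR_ge0 ?powR_le1.
by rewrite ler_piMl ?powR_ge0 ?powR_le1.
Qed.

Let is_derive_powR a x : 0 < x ->
  is_derive x 1 (fun z : R => z `^ a) (a * x `^ (a - 1)).
Proof.
move=> x0; apply: DeriveDef.
  by apply: derivable_powR; rewrite in_itv/= x0.
by rewrite -derive1E powR_derive1// in_itv/= x0.
Qed.

Let is_derive_prim a b x : 0 < a -> 0 < b -> 0 < x < 1 ->
  is_derive x 1 (prim a b) (sing a b x).
Proof.
move=> a0 b0 /andP[x0 x1].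
have y0 : 0 < 1 - x by rewrite subr_gt0.
have dx := is_derive_powR a x0.
have dy := is_derive_powR b y0.
have d1 : is_derive x 1 (fun z : R => 1 - z) (-1).
  by rewrite -[X in is_derive _ _ _ X]add0r; apply: is_deriveB.
have dyc : is_derive x 1 (fun z : R => (1 - z) `^ b) (- (b * (1 - x) `^ (b - 1))).
  have := @is_derive1_comp R (fun z : R => z `^ b) (fun z => 1 - z) x _ _ dy d1.
  by rewrite mulrN1.

rewrite [X in is_derive _ _ _ X](_ : _ = a^-1 *: (a * x `^ (a - 1))
   - b^-1 *: (- (b * (1 - x) `^ (b - 1)))); last first.
  rewrite /sing /GRing.scale/= mulrN opprK !mulrA !mulVf ?mul1r//.
    by rewrite gt_eqF.
  by rewrite gt_eqF.
apply: is_deriveB.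
Qed.

Let continuous_powR a x : 0 < x -> {for x, continuous (fun z : R => z `^ a)}.
Proof.
move=> x0; apply: differentiable_continuous; apply/derivable1_diffP.
by apply: derivable_powR; rewrite in_itv/= x0.
Qed.

Let continuous_prim a b x : 0 < a -> 0 < b -> 0 < x < 1 ->
  {for x, continuous (prim a b)}.
Proof.
move=> a0 b0 x01; apply: differentiable_continuous; apply/derivable1_diffP.
by have [] := is_derive_prim a0 b0 x01.
Qed.

Let continuous_sing a b x : 0 < x < 1 -> {for x, continuous (sing a b)}.
Proof.
move=> /andP[x0 x1]; apply: (@continuousD _ R^o).
  exact: continuous_powR.
apply: (@continuous_comp _ _ _ (fun z : R => 1 - z) (fun z => z `^ (b - 1))).
  by apply: (@continuousB _ R^o) => //; exact: cst_continuous.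
by apply: continuous_powR; rewrite subr_gt0.
Qed.

Let integral_sing_le a b (u v : R) : 0 < a -> 0 < b -> 0 < u -> u < v -> v < 1 ->
  (\int[mu]_(x in `[u, v]) (sing a b x)%:E <= (a^-1 + b^-1)%:E)%E.
Proof.
move=> a0 b0 u0 uv v1.
rewrite (@continuous_FTC2 _ _ (prim a b))//.
- have u01 : 0 < u < 1 by lra.
  have v01 : 0 < v < 1 by lra.
  have u01' : 0 < 1 - u < 1 by lra.
  have av : a^-1 * v `^ a <= a^-1.
    by rewrite ler_piMr ?invr_ge0 ?powR_le1 ?(ltW a0).
  have bu : b^-1 * (1 - u) `^ b <= b^-1.
    by rewrite ler_piMr ?invr_ge0 ?powR_le1 ?(ltW b0).
  have bv : 0 <= b^-1 * (1 - v) `^ b.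
    by rewrite mulr_ge0 ?powR_ge0 ?invr_ge0 ?(ltW b0).
  have au : 0 <= a^-1 * u `^ a by rewrite mulr_ge0 ?powR_ge0 ?invr_ge0 ?(ltW a0).
  by rewrite -EFinB lee_fin /prim; lra.
- apply: continuous_in_subspaceT => x; rewrite inE/= in_itv/= => /andP[ux xv].
  by apply: continuous_sing; lra.
- split.
  + move=> x; rewrite in_itv/= => /andP[ux xv].
    have x01 : 0 < x < 1 by lra.
    by have [] := is_derive_prim a0 b0 x01.
  + apply: cvg_at_right_filter; apply: continuous_prim => //.
    by lra.
  + apply: cvg_at_left_filter; apply: continuous_prim => //.
    by lra.
- move=> x; rewrite in_itv/= => /andP[ux xv].
  have x01 : 0 < x < 1 by lra.
  by rewrite derive1E; have [_ ->] := is_derive_prim a0 b0 x01.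
Qed.

Let itvn (n : nat) : set R := `[n.+3%:R^-1, 1 - n.+3%:R^-1].

Let bigcup_itvn : \bigcup_n itvn n = `]0, 1[%classic :> set R.
Proof.
apply/seteqP; split => [x [n _]|x]; rewrite /itvn/= !in_itv/=.
  have : 0 < n.+3%:R^-1 :> R by [].
  by move: (n.+3%:R^-1) => e e0 /andP[? ?]; lra.
move=> /andP[x0 x1].
pose d := Num.min x (1 - x).
have d0 : 0 < d by rewrite lt_min x0 subr_gt0.
exists (Num.truncn d^-1) => //=; rewrite in_itv/=.
have dn : (Num.truncn d^-1).+3%:R^-1 <= d.
  rewrite -[leRHS]invrK lef_pV2 ?posrE ?invr_gt0// ltW//.
  rewrite (lt_le_trans (truncnS_gt _))// ler_nat.
  by rewrite -addn3 -addn1 leq_add2l.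
rewrite (le_trans dn) ?ge_min ?lexx//=.
by rewrite lerBrDr -lerBrDl (le_trans dn)// ge_min lexx orbT.
Qed.

Let integral_sing_lty a b : 0 < a -> 0 < b ->
  (\int[mu]_(x in `]0%R, 1%R[) (sing a b x)%:E < +oo)%E.
Proof.
move=> a0 b0; rewrite -bigcup_itvn.
apply: (@le_lt_trans _ _ (a^-1 + b^-1)%:E); last exact: ltry.
have cv : (\int[mu]_(x in itvn n) (sing a b x)%:E)%E @[n --> \oo] -->
    (\int[mu]_(x in \bigcup_n itvn n) (sing a b x)%:E)%E.
  apply: ge0_nondecreasing_set_cvg_integral.
  - move=> m n mn; apply/subsetPset => x; rewrite /itvn/= !in_itv/=.
    have : n.+3%:R^-1 <= m.+3%:R^-1 :> R by rewrite lef_pV2 ?posrE// ler_nat.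
    by move: (n.+3%:R^-1) (m.+3%:R^-1) => e f ef /andP[? ?]; lra.
  - by move=> n; exact: measurable_itv.
  - move=> n; apply/measurable_EFinP/measurable_funTS.
    exact: measurable_sing.
  - by move=> n x _; rewrite lee_fin sing_ge0.
rewrite -(cvg_lim _ cv)//; apply: lime_le; first by apply/cvg_ex; eexists; exact: cv.
apply: nearW => n; apply: integral_sing_le => //.
have h : n.+3%:R^-1 < 2^-1 :> R by rewrite ltf_pV2 ?posrE// ltr_nat.
by move: (n.+3%:R^-1) h => e h; lra.
Qed.

Lemma integral_Beta_weight_lty a b : 0 < a -> 0 < b ->
  (\int[mu]_(x in `]0%R, 1%R[) (Beta_weight a b x)%:E < +oo)%E.
Proof.
move=> a0 b0; apply: le_lt_trans (integral_sing_lty a0 b0).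
apply: ge0_le_integral => //=.
- by move=> x _; rewrite lee_fin Beta_weight_ge0.
- by apply/measurable_EFinP/measurable_funTS; exact: measurable_Beta_weight.
- by apply/measurable_EFinP/measurable_funTS; exact: measurable_sing.
- by move=> x; rewrite in_itv/= => x01; rewrite lee_fin weight_le_sing.
Qed.

Lemma EFin_Beta_fun a b : 0 < a -> 0 < b ->
  (\int[mu]_(x in `]0%R, 1%R[) (Beta_weight a b x)%:E)%E = (Beta_fun a b)%:E.
Proof.
move=> a0 b0; rewrite /Beta_fun /Rintegral fineK// ge0_fin_numE.
  exact: integral_Beta_weight_lty.
by apply: integral_ge0 => x _; rewrite lee_fin Beta_weight_ge0.
Qed.

Let quarter : set R := `[4^-1, 1 - 4^-1].

Lemma Beta_fun_gt0 a b : 0 < a -> 0 < b -> 0 < Beta_fun a b.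
Proof.
move=> a0 b0; rewrite -lte_fin -EFin_Beta_fun//.
pose m : R := 4^-1 `^ a * 4^-1 `^ b.
have mq : measurable quarter by exact: measurable_itv.
have m0 : 0 < m by rewrite mulr_gt0// powR_gt0.
apply: (@lt_le_trans _ _ (\int[mu]_(x in quarter) m%:E)%E).
  rewrite /quarter integral_cst//= lebesgue_measure_itv/= lte_fin ifT; last by lra.
  by rewrite -EFinB -EFinM lte_fin mulr_gt0//; lra.
apply: (@le_trans _ _ (\int[mu]_(x in quarter) (Beta_weight a b x)%:E)%E).
  apply: ge0_le_integral => //=.
  - by move=> x _; rewrite lee_fin ltW.
  - by apply/measurable_EFinP/measurable_funTS; exact: measurable_Beta_weight.
  - move=> x; rewrite /quarter/= in_itv/= => /andP[x1 x3]; rewrite lee_fin.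
    have x0 : 0 < x by lra.
    have y0 : 0 < 1 - x by lra.
    have pw (z c : R) : 4^-1 <= z -> z <= 1 -> 0 < c -> 4^-1 `^ c <= z `^ (c - 1).
      move=> z4 z1 c0; have z0 : 0 < z by lra.
      apply: (@le_trans _ _ (z `^ c)).
        apply: (ge0_ler_powR (ltW c0)) => //; rewrite nnegrE ?(ltW z0)//.
      by rewrite -(mulr_powRB1 (ltW z0) c0) ler_piMl ?powR_ge0.
    by rewrite ler_pM ?powR_ge0// pw//; lra.
apply: ge0_subset_integral => //=.
- by apply/measurable_EFinP/measurable_funTS; exact: measurable_Beta_weight.
- by move=> x _; rewrite lee_fin Beta_weight_ge0.
- by move=> x; rewrite /quarter/= !in_itv/= => /andP[? ?]; lra.
Qed.

Lemma Beta_pdf_ge0 a b x : 0 <= Beta_pdf a b x.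
Proof.
apply: restrict_ge0 => {}x _; rewrite divr_ge0 ?Beta_weight_ge0//.
by apply: Rintegral_ge0 => y _; exact: Beta_weight_ge0.
Qed.

Lemma measurable_Beta_pdf a b : measurable_fun [set: R] (Beta_pdf a b).
Proof.
apply/measurable_restrict => //; apply: measurable_funTS.
by apply: measurable_funM => //; exact: measurable_Beta_weight.
Qed.

Lemma integral_Beta_pdf a b : 0 < a -> 0 < b ->
  (\int[mu]_x (Beta_pdf a b x)%:E = 1)%E.
Proof.
move=> a0 b0.
transitivity (\int[mu]_(x in `]0%R, 1%R[)
    ((Beta_weight a b x)%:E * (Beta_fun a b)^-1%:E))%E.
  rewrite [RHS]integral_mkcond; apply: eq_integral => x _.
  by rewrite /Beta_pdf !patchE; case: ifP.
rewrite ge0_integralZr//=.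
- by rewrite EFin_Beta_fun// -EFinM divff// gt_eqF// Beta_fun_gt0.
- by apply/measurable_EFinP/measurable_funTS; exact: measurable_Beta_weight.
- by move=> x _; rewrite lee_fin Beta_weight_ge0.
- by rewrite lee_fin invr_ge0 ltW// Beta_fun_gt0.
Qed.

End Beta_fun.

Definition Beta_prob (R : realType) (a b : R) (a0 : 0 < a) (b0 : 0 < b)
    (A : set (measurableTypeR R)) : \bar R :=
  (\int[lebesgue_measure]_(x in A) (Beta_pdf a b x)%:E)%E.

Section Beta_prob.
Context (R : realType) (a b : R) (a0 : 0 < a) (b0 : 0 < b).

Let Beta_prob0 : Beta_prob a0 b0 set0 = 0%E.
Proof. by rewrite /Beta_prob integral_set0. Qed.

Let Beta_prob_ge0 A : (0 <= Beta_prob a0 b0 A)%E.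
Proof. by apply: integral_ge0 => x _; rewrite lee_fin Beta_pdf_ge0. Qed.

Let Beta_prob_sigma_additive : semi_sigma_additive (Beta_prob a0 b0).
Proof.
move=> /= F mF tF mUF; rewrite /Beta_prob; apply: cvg_toP.
  apply: ereal_nondecreasing_is_cvgn => m n mn.
  apply: lee_sum_nneg_natr => // k _ _.
  by apply: integral_ge0 => /= x Fkx; rewrite lee_fin Beta_pdf_ge0.
rewrite ge0_integral_bigcup//=.
- apply/measurable_funTS/measurableT_comp => //.
  exact: measurable_Beta_pdf.
- by move=> x _; rewrite lee_fin Beta_pdf_ge0.
Qed.

HB.instance Definition _ := isMeasure.Build _ _ _ (Beta_prob a0 b0)
  Beta_prob0 Beta_prob_ge0 Beta_prob_sigma_additive.

Let Beta_prob_setT : Beta_prob a0 b0 [set: _] = 1%E.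
Proof. by rewrite /Beta_prob integral_Beta_pdf. Qed.

HB.instance Definition _ := @Measure_isProbability.Build _ _ R
  (Beta_prob a0 b0) Beta_prob_setT.

End Beta_prob.

(* Main.v *)
(* Near the edge 1 the density g is within a factor 1 +- e of c (1 - x)^(b-1),
   while on [0, q] with q < 1 the factor x^k is at most q^k; hence
   |m_k - c B(k+1, b)| <= e c B(k+1, b) + O(q^k). The substitution x = 1 - t/k
   and dominated convergence turn k^b B(k+1, b) into the integral of
   t^(b-1) (1 - t/k)^k over ]0, k[, which tends to Gamma(b). The exact Beta
   moments come from a B(a, b) = (a + b) B(a+1, b), and the Beta-Gamma relation
   from comparing the limits of k^s B(k+1, s) for s = a and s = a + b. *)
Require Import Defs.
From mathcomp Require Import all_boot all_order all_algebra.
From mathcomp Require Import all_classical all_reals all_analysis.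
From mathcomp Require Import measurable_realfun ftc ring lra.

Set Implicit Arguments.
Unset Strict Implicit.
Unset Printing Implicit Defensive.

Import Order.TTheory GRing.Theory Num.Theory.
Import numFieldNormedType.Exports.

Local Open Scope classical_set_scope.
Local Open Scope ring_scope.

(** * Integrable combinations, integrals against a density, affine substitution *)

Lemma integrableZl_EFin d (T : measurableType d) (R : realType)
    (mu : {measure set T -> \bar R}) (D : set T) (f : T -> R) (r : R) :
  measurable D -> mu.-integrable D (EFin \o f) ->
  mu.-integrable D (EFin \o (fun x => r * f x)).
Proof.
move=> mD fi; apply: (eq_integrable mD (fun x => r%:E * (EFin \o f) x)%E) => //.
exact: integrableZl.
Qed.

Lemma integrableD_EFin d (T : measurableType d) (R : realType)
    (mu : {measure set T -> \bar R}) (D : set T) (f g : T -> R) :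
  measurable D -> mu.-integrable D (EFin \o f) -> mu.-integrable D (EFin \o g) ->
  mu.-integrable D (EFin \o (fun x => f x + g x)).
Proof.
move=> mD fi gi.
apply: (eq_integrable mD (fun x => (EFin \o f) x + (EFin \o g) x)%E) => //.
exact: integrableD.
Qed.

Lemma integrableB_EFin d (T : measurableType d) (R : realType)
    (mu : {measure set T -> \bar R}) (D : set T) (f g : T -> R) :
  measurable D -> mu.-integrable D (EFin \o f) -> mu.-integrable D (EFin \o g) ->
  mu.-integrable D (EFin \o (fun x => f x - g x)).
Proof.
move=> mD fi gi.
apply: (eq_integrable mD (fun x => (EFin \o f) x - (EFin \o g) x)%E) => //.
exact: integrableB.
Qed.

(** The Radon-Nikodym derivative of [G] has the same integral as [g] over every measurable set, so
    the two agree almost everywhere and the change-of-measure formula passes from that derivative to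
    [g]. *)
Lemma ge0_integral_density (R : realType)
    (G : probability (measurableTypeR R) R) (g : R -> R) (D : set R)
    (f : R -> \bar R) :
  has_density G g -> measurable D -> measurable_fun D f ->
  (forall x, D x -> 0 <= f x)%E ->
  (\int[G]_(x in D) f x = \int[lebesgue_measure]_(x in D) (f x * (g x)%:E))%E.
Proof.
move=> [mg g0 Gg] mD mf f0; set mu := lebesgue_measure.
have Gmu : G `<< mu.
  apply/null_content_dominatesP => A mA muA0; rewrite Gg//.
  by apply: null_set_integral => //; apply/measurable_EFinP/measurable_funTS.
pose h := Radon_Nikodym_SigmaFinite.f G mu.
pose f1 := f \_ D.
have f10 x : (0 <= f1 x)%E by apply: erestrict_ge0.
have mf1 : measurable_fun [set: R] f1 by apply/measurable_restrict => //; rewrite setTI.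
have E : ae_eq mu setT h (EFin \o g).
  apply: integral_ae_eq => //.
  - exact: Radon_Nikodym_SigmaFinite.f_integrable.
  - exact/measurable_EFinP.
  - move=> A _ mA; apply: etrans (Gg A mA).
    exact/esym/Radon_Nikodym_SigmaFinite.f_integral.
transitivity (\int[G]_x f1 x)%E; first by rewrite integral_mkcond.
rewrite -(Radon_Nikodym_SigmaFinite.change_of_variables Gmu f10 measurableT mf1).
transitivity (\int[mu]_x (f1 x * (g x)%:E))%E.
  apply: ge0_ae_eq_integral => //.
  - apply: emeasurable_funM => //.
    exact: measurable_int (Radon_Nikodym_SigmaFinite.f_integrable Gmu).
  - by apply: emeasurable_funM => //; exact/measurable_EFinP.
  - by move=> x _; rewrite mule_ge0// Radon_Nikodym_SigmaFinite.f_ge0.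
  - by move=> x _; rewrite mule_ge0// lee_fin.
  - by apply: ae_eqe_mul2l.
rewrite [RHS]integral_mkcond; apply: eq_integral => x _.
by rewrite /f1 !patchE; case: ifP => //; rewrite mul0e.
Qed.

(** By uniqueness of Lebesgue measure: the pushforward under [phi], scaled by [r^-1], gives each
    half-open interval its length. *)
Lemma lebesgue_measure_reflect_scale (R : realType) (u r : R) (r0 : 0 < r)
    (A : set R) : measurable A ->
  (lebesgue_measure ((fun t => u - t / r)%R @^-1` A) = r%:E * lebesgue_measure A)%E.
Proof.
move=> mA; have rV0 : 0 <= r^-1 by rewrite invr_ge0 ltW.
pose phi (t : measurableTypeR R) : measurableTypeR R := u - t / r.
have mphi : measurable_fun setT phi.
  by apply: measurable_funB => //; exact: measurable_funM.
pose nu : {measure set measurableTypeR R -> \bar R} :=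
  mscale (NngNum rV0) (pushforward lebesgue_measure phi).
suff -> : lebesgue_measure A = nu mphi A.
  rewrite /nu/= /mscale/= muleA -EFinM mulfV ?mul1e//; exact: lt0r_neq0.
apply: lebesgue_measure_unique => // _ [[a b]] _ <-.
rewrite /nu/= /mscale/= /pushforward/=.
(* [phi] is decreasing, so the open end moves from left to right; lengths are not affected. *)
have -> : phi @^-1` `]a, b] = `[r * (u - b), r * (u - a)[%classic.
  apply/seteqP; split => t; rewrite /phi/= !in_itv/= ![r * _]mulrC
    -(ler_pdivlMr _ _ r0) -(ltr_pdivrMr _ _ r0) => /andP[h1 h2];
    apply/andP; split; lra.
rewrite !lebesgue_measure_itv/= !lte_fin ltr_pM2l// ltrD2l ltrN2.
case: ifP => _; last by rewrite mule0.
rewrite -!EFinB -EFinM; congr EFin; rewrite -mulrBr mulKf ?lt0r_neq0//; ring.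
Qed.

(** The substitution [x = u - t / r], used below with [u = 1] and [r = k.+1] to zoom in on the
    edge. *)
Lemma ge0_integral_reflect_scale (R : realType) (u r : R) (D : set R)
    (f : R -> \bar R) :
  0 < r -> measurable D -> measurable_fun D f -> (forall x, D x -> 0 <= f x)%E ->
  (\int[lebesgue_measure]_(x in D) f x =
   r^-1%:E * \int[lebesgue_measure]_(t in (fun t => u - t / r)%R @^-1` D)
     f (u - t / r)%R)%E.
Proof.
move=> r0 mD mf f0; have rV0 : 0 <= r^-1 by rewrite invr_ge0 ltW.
pose phi (t : measurableTypeR R) : measurableTypeR R := u - t / r.
have mphi : measurable_fun setT phi.
  by apply: measurable_funB => //; exact: measurable_funM.
pose nu : {measure set measurableTypeR R -> \bar R} :=
  pushforward lebesgue_measure phi.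
have <- : (\int[nu mphi]_(x in D) f x =
    \int[lebesgue_measure]_(t in (fun t => u - t / r)%R @^-1` D)
      f (u - t / r)%R)%E.
  by apply: ge0_integral_pushforward => // x /set_mem; exact: f0.
rewrite -[r^-1]/((NngNum rV0)%:num).
rewrite -(ge0_integral_mscale (nu mphi) mD (NngNum rV0) mf f0).
apply: eq_measure_integral => A mA AD.
transitivity (r^-1%:E * lebesgue_measure (phi @^-1` A))%E => //.
rewrite (lebesgue_measure_reflect_scale u r0 mA).
by rewrite muleA -EFinM mulVf ?mul1e// lt0r_neq0.
Qed.

(** * Beta integrals *)

Section beta_recursion.
Context (R : realType).
Implicit Types (a b s x : R).
Local Notation mu := (@lebesgue_measure R).

Lemma cvg_powR0 b (u : R^nat) : 0 < b -> (forall n, 0 < u n) ->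
  u n @[n --> \oo] --> 0 -> u n `^ b @[n --> \oo] --> 0.
Proof. by move=> b0 u0 cu; have /cvg_at_rightP := @powR_cvg0 R b b0; apply. Qed.

Lemma cvg_powRN b : 0 < b -> (k%:R : R) `^ (- b) @[k --> \oo] --> 0.
Proof.
(* The shift drops [k = 0], so that the base is the positive harmonic sequence. *)
move=> b0; rewrite -cvg_shiftS.
under eq_fun do rewrite -mulN1r powRrM powR_inv1//.
apply: cvg_powR0 => //; exact: cvg_harmonic.
Qed.

Lemma is_derive_powR a x : 0 < x ->
  is_derive x 1 (fun z : R => z `^ a) (a * x `^ (a - 1)).
Proof.
move=> x0; apply: DeriveDef.
  by apply: derivable_powR; rewrite in_itv/= x0.
by rewrite -derive1E powR_derive1// in_itv/= x0.
Qed.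

Lemma continuous_powR a x : 0 < x -> {for x, continuous (fun z : R => z `^ a)}.
Proof.
move=> x0; apply: differentiable_continuous; apply/derivable1_diffP.
by apply: derivable_powR; rewrite in_itv/= x0.
Qed.

Lemma continuous_Beta_weight a b x : 0 < x < 1 ->
  {for x, continuous (Beta_weight a b)}.
Proof.
move=> /andP[x0 x1]; apply: (@continuousM _ R^o).
  exact: continuous_powR.
apply: (@continuous_comp _ _ _ (fun z : R => 1 - z) (fun z => z `^ (b - 1))).
  by apply: (@continuousB _ R^o) => //; exact: cst_continuous.
by apply: continuous_powR; rewrite subr_gt0.
Qed.

Let mulr_gt0_powRB1 x a : 0 < x -> x * x `^ (a - 1) = x `^ a.
Proof.
move=> x0; rewrite powRB; last by rewrite (gt_eqF x0) implybT.
by rewrite powRr1 ?ltW// mulrC divfK// gt_eqF.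
Qed.

(** The product rule, with [x^(a-1) (1-x)^(b-1)] factored out, leaves
    [a (1 - x) - b x = a - (a + b) x]. No sign of [a] is assumed, since [Beta_fun1] takes
    [a = 0]. *)
Lemma is_derive_Beta_prim a b x : 0 < x < 1 ->
  is_derive x 1 (fun z => z `^ a * (1 - z) `^ b)
    (a * Beta_weight a b x - (a + b) * Beta_weight (a + 1) b x).
Proof.
move=> /andP[x0 x1].
have y0 : 0 < 1 - x by rewrite subr_gt0.
have dx := is_derive_powR a x0.
have dy := is_derive_powR b y0.
have d1 : is_derive x 1 (fun z : R => 1 - z) (-1).
  by rewrite -[X in is_derive _ _ _ X]add0r; apply: is_deriveB.
have dyc : is_derive x 1 (fun z : R => (1 - z) `^ b) (- (b * (1 - x) `^ (b - 1))).
  have := @is_derive1_comp R (fun z : R => z `^ b) (fun z => 1 - z) x _ _ dy d1.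
  by rewrite mulrN1.
rewrite [X in is_derive _ _ _ X](_ : _ =
   x `^ a *: (- (b * (1 - x) `^ (b - 1))) + (1 - x) `^ b *: (a * x `^ (a - 1))).
  exact: is_deriveM.
rewrite /Beta_weight /GRing.scale/= addrK.
rewrite -(mulr_gt0_powRB1 a x0) -(mulr_gt0_powRB1 b y0).
by ring.
Qed.

(** Starting at 1/3 keeps [e_ n] below 1/2, so each interval from [e_ n] to [1 - e_ n] is
    nondegenerate. *)
Let e_ n : R := n.+3%:R^-1.

Let e_gt0 n : 0 < e_ n. Proof. by rewrite invr_gt0. Qed.

Let e_lt n : e_ n < 2^-1. Proof. by rewrite ltf_pV2 ?posrE// ltr_nat. Qed.

Let cvg_e : e_ @ \oo --> 0.
Proof.
have := @cvg_harmonic R; rewrite -cvg_shiftS -cvg_shiftS; exact.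
Qed.

Let itvn n : set R := `[e_ n, 1 - e_ n].

Let bigcup_itvn : \bigcup_n itvn n = `]0, 1[%classic.
Proof.
apply/seteqP; split => [x [n _]|x]; rewrite /itvn/= !in_itv/=.
  by have := e_gt0 n; move: (e_ n) => e e0 /andP[? ?]; lra.
move=> /andP[x0 x1].
have d0 : 0 < Num.min x (1 - x) by rewrite lt_min x0 subr_gt0.
have /cvgrPdist_lt/(_ _ d0)[N _ /(_ N (leqnn N))] := cvg_e.
rewrite /= sub0r normrN gtr0_norm// lt_min => /andP[h1 h2].
by exists N => //=; rewrite in_itv/=; lra.
Qed.

(** Monotone convergence along the growing intervals. The Beta weights may blow up at 0 and 1, so
    the fundamental theorem of calculus is applied on [itvn n] before passing to the limit. *)
Let cvg_integral_itvn (f : R -> R) (l : R) : measurable_fun setT f ->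
  (forall x, 0 <= f x) -> (\int[mu]_(x in `]0%R, 1%R[) (f x)%:E = l%:E)%E ->
  \int[mu]_(x in itvn n) f x @[n --> \oo] --> l.
Proof.
move=> mf f0 fl; apply: fine_cvg; rewrite -fl -bigcup_itvn.
apply: ge0_nondecreasing_set_cvg_integral.
- move=> m n mn; apply/subsetPset => x; rewrite /itvn/= !in_itv/=.
  have : e_ n <= e_ m by rewrite lef_pV2 ?posrE// ler_nat.
  by move: (e_ n) (e_ m) => e f' ef /andP[? ?]; lra.
- by move=> n; exact: measurable_itv.
- by move=> n; apply/measurable_EFinP/measurable_funTS.
- by move=> n x _; rewrite lee_fin.
Qed.

Let integrable_itvn_Beta_weight a b n :
  mu.-integrable (itvn n) (EFin \o Beta_weight a b).
Proof.
apply: continuous_compact_integrable; first exact: segment_compact.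
apply: continuous_in_subspaceT => x; rewrite inE /itvn/= in_itv/= => /andP[ux xv].
by apply: continuous_Beta_weight; have := e_gt0 n; lra.
Qed.

Let I a b n := \int[mu]_(x in itvn n) Beta_weight a b x.

Let cvg_I a b : 0 < a -> 0 < b -> I a b n @[n --> \oo] --> Beta_fun a b.
Proof.
move=> a0 b0; apply: cvg_integral_itvn; first exact: measurable_Beta_weight.
  by move=> x; exact: Beta_weight_ge0.
exact: EFin_Beta_fun.
Qed.

Let FTC_itvn a b n (F := fun x => x `^ a * (1 - x) `^ b) :
  a * I a b n - (a + b) * I (a + 1) b n = F (1 - e_ n) - F (e_ n).
Proof.
have e0 := e_gt0 n; have e1 := e_lt n.
have i1 := integrable_itvn_Beta_weight a b n.
have i2 := integrable_itvn_Beta_weight (a + 1) b n.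
rewrite /I -!RintegralZl//; try exact: measurable_itv.
rewrite -RintegralB; try exact: measurable_itv; last 2 first.
- by apply: integrableZl_EFin => //; exact: measurable_itv.
- by apply: integrableZl_EFin => //; exact: measurable_itv.
rewrite /Rintegral (@continuous_FTC2 _ _ F)//; first by lra.
- apply: continuous_in_subspaceT => x; rewrite inE /itvn/= in_itv/= => /andP[ux xv].
  have x01 : 0 < x < 1 by lra.
  by apply: cvgB; (apply: cvgM; first exact: cvg_cst);
    exact: continuous_Beta_weight.
- have cF x : 0 < x < 1 -> {for x, continuous F}.
    move=> x01; apply: differentiable_continuous; apply/derivable1_diffP.
    by have [] := is_derive_Beta_prim a b x01.
  split.
  + move=> x; rewrite in_itv/= => /andP[ux xv].
    have x01 : 0 < x < 1 by lra.
    by have [] := is_derive_Beta_prim a b x01.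
  + by apply: cvg_at_right_filter; apply: cF; lra.
  + by apply: cvg_at_left_filter; apply: cF; lra.
- move=> x; rewrite in_itv/= => /andP[ux xv].
  have x01 : 0 < x < 1 by lra.
  by rewrite derive1E; have [_ ->] := is_derive_Beta_prim a b x01.
Qed.

(** Limit of [FTC_itvn]: both boundary terms vanish because [a] and [b] are positive. *)
Lemma Beta_funDl a b : 0 < a -> 0 < b ->
  (a + b) * Beta_fun (a + 1) b = a * Beta_fun a b.
Proof.
move=> a0 b0; have a1 : 0 < a + 1 by rewrite addr_gt0.
pose F x := x `^ a * (1 - x) `^ b.
have le1 x c : 0 < x < 1 -> 0 < c -> x `^ c <= 1.
  move=> /andP[x0 x1] c0; have := @ge0_ler_powR R c (ltW c0) x 1.
  by rewrite powR1; apply; rewrite ?nnegrE ?ltW.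
have cF0 : F (1 - e_ n) - F (e_ n) @[n --> \oo] --> 0.
  rewrite -[X in _ --> X](subrr 0); apply: cvgB.
    apply: (@squeeze_cvgr _ _ _ _ (cst 0) (fun n => e_ n `^ b)); last 2 first.
    - exact: cvg_cst.
    - exact: cvg_powR0.
    apply: nearW => n; have := e_gt0 n; have := e_lt n => h1 h0.
    (* At the right end the factor [(1 - e_ n)^a] is at most 1, which leaves [e_ n ^ b]; the left
       end is symmetric. *)
    rewrite /F subKr mulr_ge0 ?powR_ge0//= ler_piMl ?powR_ge0// le1//; lra.
  apply: (@squeeze_cvgr _ _ _ _ (cst 0) (fun n => e_ n `^ a)); last 2 first.
  - exact: cvg_cst.
  - exact: cvg_powR0.
  apply: nearW => n; have := e_gt0 n; have := e_lt n => h1 h0.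
  rewrite /F mulr_ge0 ?powR_ge0//= ler_piMr ?powR_ge0// le1//; lra.
have cL : a * I a b n - (a + b) * I (a + 1) b n @[n --> \oo] -->
    a * Beta_fun a b - (a + b) * Beta_fun (a + 1) b.
  by apply: cvgB; apply: cvgM; try exact: cvg_cst; exact: cvg_I.
have cL0 : a * I a b n - (a + b) * I (a + 1) b n @[n --> \oo] --> 0.
  by under eq_fun do rewrite FTC_itvn.
exact/esym/subr0_eq/(cvg_unique _ cL cL0).
Qed.

Lemma Beta_fun1 b : 0 < b -> Beta_fun 1 b = b^-1.
Proof.
move=> b0.
have cL : - b * I 1 b n @[n --> \oo] --> - b * Beta_fun 1 b.
  by apply: cvgM; [exact: cvg_cst|exact: cvg_I].
have cL1 : - b * I 1 b n @[n --> \oo] --> 0 - 1 `^ b.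
  (* At [a = 0] the first integral drops out of [FTC_itvn] and [F] reduces to [(1 - x)^b]. *)
  have E n : - b * I 1 b n = e_ n `^ b - (1 - e_ n) `^ b.
    have /= := FTC_itvn 0 b n.
    by rewrite !add0r mul0r add0r !powRr0 !mul1r subKr mulNr.
  under eq_fun do rewrite E.
  apply: cvgB; first exact: cvg_powR0.
  have c1 : 1 - e_ n @[n --> \oo] --> (1 : R).
    by rewrite -[X in _ --> X]subr0; apply: cvgB => //; exact: cvg_cst.
  apply: (@cvg_comp _ _ _ (fun n => 1 - e_ n) (fun x : R => x `^ b) \oo
    (nbhs (1 : R)) (nbhs ((1 : R) `^ b))) => //.
  exact: continuous_powR.
have : - b * Beta_fun 1 b = 0 - 1 `^ b by exact: (cvg_unique _ cL cL1).
rewrite powR1 sub0r mulNr => /oppr_inj H.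
by apply: (mulfI (lt0r_neq0 b0)); rewrite H// mulfV// lt0r_neq0.
Qed.

Lemma Beta_funDn a b k : 0 < a -> 0 < b ->
  Beta_fun (a + k%:R) b = Beta_fun a b * (rising_fact a k / rising_fact (a + b) k).
Proof.
move=> a0 b0; rewrite /rising_fact.
elim: k => [|k IH]; first by rewrite addr0 !big_ord0 divr1 mulr1.
have ak : 0 < a + k%:R by rewrite ltr_wpDr.
have abk : 0 < a + k%:R + b by rewrite addr_gt0.
have -> : a + k.+1%:R = a + k%:R + 1 by rewrite -natr1 addrA.
apply: (mulfI (lt0r_neq0 abk)); rewrite Beta_funDl// IH !big_ord_recr/=.
have nz : \prod_(i < k) (a + b + i%:R) != 0.
  by rewrite prodf_seq_neq0; apply/allP => i _; rewrite lt0r_neq0// ltr_wpDr ?addr_gt0.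
by field; rewrite nz addrAC lt0r_neq0.
Qed.

End beta_recursion.

Lemma integrable_Beta_weight (R : realType) (a b : R) : 0 < a -> 0 < b ->
  (@lebesgue_measure R).-integrable `]0, 1[ (EFin \o Beta_weight a b).
Proof.
move=> a0 b0; apply/integrableP; split.
  by apply/measurable_EFinP/measurable_funTS; exact: measurable_Beta_weight.
under eq_integral do rewrite /= ger0_norm ?Beta_weight_ge0//.
exact: integral_Beta_weight_lty.
Qed.

(** * The Gamma integral as a limit of Beta integrals *)

Section gamma.
Context (R : realType).
Implicit Types (a b s x t : R).
Local Notation mu := (@lebesgue_measure R).

Let gamma_fun s t := t `^ (s - 1) * expR (- t).

Let measurable_gamma_fun s : measurable_fun setT (gamma_fun s).
Proof.
apply: measurable_funM; first exact: measurable_powR.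
by apply: measurableT_comp => //; exact: measurable_expR.
Qed.

Let gamma_fun_ge0 s t : 0 <= gamma_fun s t.
Proof. by rewrite mulr_ge0 ?powR_ge0 ?expR_ge0. Qed.

(** Domination: by [t^(s-1)], a Beta weight, on []0, 1[], and by a multiple of the exponential
    density of rate 1/2 from 1 on. *)
Lemma integrable_Gamma_integrand s : 0 < s ->
  mu.-integrable `]0, +oo[ (EFin \o (fun t => t `^ (s - 1) * expR (- t))).
Proof.
move=> s0; rewrite -/(gamma_fun s).
pose N := Num.truncn (s - 1).
(* Chosen so that [t^(N+1) <= C exp(t/2)], from the Taylor term of order [N.+1] of [exp(t/2)]. *)
pose C : R := 2 ^+ N.+1 * N.+1`!%:R.
have C0 : 0 <= C by rewrite mulr_ge0 ?exprn_ge0.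
have p0 : 0 < 2^-1 :> R by [].
pose h1 : R -> R := Beta_weight s 1 \_ `]0, 1[.
(* The factor 2 cancels the rate 1/2 in front of the density. *)
pose h2 t : R := C * 2 * exponential_pdf 2^-1 t.
pose h t : R := h1 t + h2 t.
have ih : mu.-integrable setT (EFin \o h).
  apply: integrableD_EFin => //.
    rewrite -restrict_EFin; apply: (@integrable_mkcond _ _ _ mu _
      (EFin \o Beta_weight s 1) (measurable_itv `]0%R, 1%R[)).1.
    exact: integrable_Beta_weight.
  by apply: integrableZl_EFin => //; exact: integrable_exponential_pdf.
have ihD : mu.-integrable `]0, +oo[ (EFin \o h).
  by apply: integrableS ih => //; exact: measurable_itv.
apply: le_integrable ihD; first exact: measurable_itv.
- by apply/measurable_EFinP/measurable_funTS; exact: measurable_gamma_fun.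
- move=> t; rewrite /= in_itv/= andbT => t0.
  have e0 : 0 <= C * 2 * exponential_pdf 2^-1 t.
    by rewrite !mulr_ge0 ?exponential_pdf_ge0.
  rewrite lee_fin ger0_norm// (le_trans _ (ler_norm _))// /h /h1 /h2 patchE.
  case: ifPn => [_|].
    rewrite ler_wpDr// /gamma_fun /Beta_weight subrr powRr0 ler_wpM2l ?powR_ge0//.
    by rewrite expR_le1 oppr_le0 ltW.
  rewrite notin_setE/= in_itv/= t0/= => /negP; rewrite -leNgt => t1.
  rewrite add0r exponential_pdfE ?(ltW t0)// mulrA mulfK// /gamma_fun.
  (* One half of the decay absorbs the power of [t], the other matches the density. *)
  have -> : expR (- t) = expR (- 2^-1 * t) * expR (- 2^-1 * t).
    by rewrite -expRD; congr expR; lra.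
  rewrite mulrA ler_wpM2r ?expR_ge0// mulNr expRN ler_pdivrMr ?expR_gt0//.
  have tN : t `^ (s - 1) <= t ^+ N.+1.
    rewrite -powR_mulrn ?(ltW t0)// ler_powR//.
    exact/ltW/truncnS_gt.
  apply: (le_trans tN).
  have t2 : 0 <= 2^-1 * t by rewrite mulr_ge0// ltW.
  have := expR_ge1Dxn N t2; move=> /(le_trans _)-/(_ ((2^-1 * t) ^+ N.+1 / N.+1`!%:R)).
  rewrite lerDr ler01 => /(_ isT).
  rewrite ler_pdivrMr ?ltr0n ?fact_gt0// exprMn exprVn ler_pdivrMl ?exprn_gt0//.
  by rewrite /C mulrAC mulrA.
Qed.

Lemma EFin_Gamma s : 0 < s ->
  (\int[mu]_(t in `]0%R, +oo[) (t `^ (s - 1) * expR (- t))%:E)%E = (Gamma s)%:E.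
Proof.
move=> s0; rewrite /Gamma /Rintegral fineK//.
apply: integrable_fin_num; first exact: measurable_itv.
exact: integrable_Gamma_integrand.
Qed.

(** On []0, 1[] the exponential is at least [exp(-1)], so [Gamma s] is at least
    [exp(-1) B(s, 1)]. *)
Lemma Gamma_gt0 s : 0 < s -> 0 < Gamma s.
Proof.
move=> s0; rewrite -lte_fin -EFin_Gamma//.
apply: (@lt_le_trans _ _ (\int[mu]_(x in `]0%R, 1%R[)
    ((expR (-1))%:E * (Beta_weight s 1 x)%:E))%E).
  rewrite ge0_integralZl//=.
  - by rewrite EFin_Beta_fun// -EFinM lte_fin mulr_gt0 ?expR_gt0 ?Beta_fun_gt0.
  - by apply/measurable_EFinP/measurable_funTS; exact: measurable_Beta_weight.
  - by move=> x _; rewrite lee_fin Beta_weight_ge0.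
apply: (@le_trans _ _ (\int[mu]_(x in `]0%R, 1%R[) (gamma_fun s x)%:E)%E).
  apply: ge0_le_integral => //=.
  - by move=> x _; rewrite lee_fin mulr_ge0 ?expR_ge0 ?Beta_weight_ge0.
  - apply/measurable_EFinP/measurable_funTS/measurable_funM => //.
    exact: measurable_Beta_weight.
  - by apply/measurable_EFinP/measurable_funTS; exact: measurable_gamma_fun.
  - move=> x; rewrite in_itv/= => /andP[x0 x1]; rewrite lee_fin mulrC.
    rewrite /Beta_weight subrr powRr0 mulr1 ler_wpM2l ?powR_ge0// ler_expR.
    by rewrite lerN2 ltW.
apply: ge0_subset_integral => //=.
- by apply/measurable_EFinP/measurable_funTS; exact: measurable_gamma_fun.
- by move=> x _; rewrite lee_fin gamma_fun_ge0.
- by move=> x /=; rewrite !in_itv/= => /andP[->].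
Qed.

(** With [x = t/k], both bounds are k-th powers of instances of [1 + y <= exp y]: [y = -x] above,
    and [y = x/(1-x)] below, where [1 + y = 1/(1-x)]. The upper bound also serves as the domination
    for [cvg_Beta_fun_Gamma]. *)
Lemma expR_le_onemX k t : 0 <= t < k%:R ->
  expR (- (t / (1 - t / k%:R))) <= (1 - t / k%:R) ^+ k <= expR (- t).
Proof.
move=> /andP[t0 tk]; have k0 : 0 < k%:R :> R by exact: le_lt_trans tk.
have x1 : t / k%:R < 1 by rewrite ltr_pdivrMr// mul1r.
set x := t / k%:R in x1 *; have y0 : 0 < 1 - x by rewrite subr_gt0.
have -> : t = k%:R * x by rewrite /x mulrC divfK// lt0r_neq0.
apply/andP; split.
  rewrite -mulrA -mulrN expRM_natl.
  apply: lerXn2r; rewrite ?nnegrE ?expR_ge0 ?(ltW y0)//.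
  rewrite expRN -[leRHS]invrK lef_pV2 ?posrE ?invr_gt0 ?expR_gt0//.
  apply: le_trans (expR_ge1Dx _).
  by rewrite le_eqVlt; apply/orP; left; apply/eqP; field; rewrite lt0r_neq0.
rewrite -(mulrN k%:R) expRM_natl; apply: lerXn2r; rewrite ?nnegrE ?expR_ge0 ?(ltW y0)//.
by apply: le_trans (expR_ge1Dx _).
Qed.

Lemma cvg_onemX_expR t : 0 < t ->
  (1 - t / k%:R) ^+ k @[k --> \oo] --> expR (- t).
Proof.
move=> t0.
apply: (@squeeze_cvgr _ _ _ _ (fun k => expR (- (t / (1 - t / k%:R))))
  (fun=> expR (- t))).
- exists (Num.truncn t).+1 => // k /= tk; apply: expR_le_onemX.
  rewrite ltW//=; apply: lt_le_trans (truncnS_gt t) _; by rewrite ler_nat.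
- apply: (@cvg_comp _ _ _ _ (@expR R) _ (nbhs (- t))); last exact: continuous_expR.
  apply: cvgN; rewrite -[X in _ --> X]divr1 -[X in _ / X]subr0 -[X in _ - X](mulr0 t).
  apply: cvgM; first exact: cvg_cst.
  apply: cvgV; first by rewrite mulr0 subr0.
  apply: cvgB; first exact: cvg_cst.
  apply: cvgM; first exact: cvg_cst.
  by rewrite -cvg_shiftS; exact: cvg_harmonic.
- exact: cvg_cst.
Qed.

Lemma Beta_fun_rescale k b : 0 < b ->
  (((k.+1%:R `^ b) * Beta_fun (1 + k.+1%:R) b)%:E =
  \int[mu]_(t in `]0%R, k.+1%:R[)
     (t `^ (b - 1) * (1 - t / k.+1%:R) ^+ k.+1)%:E)%E.
Proof.
move=> b0; have k0 : 0 < k.+1%:R :> R by [].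
rewrite EFinM -EFin_Beta_fun ?addr_gt0//.
rewrite (ge0_integral_reflect_scale 1 k0)//=; last 2 first.
- by apply/measurable_EFinP/measurable_funTS; exact: measurable_Beta_weight.
- by move=> x _; rewrite lee_fin Beta_weight_ge0.
have -> : (fun t => 1 - t / k.+1%:R) @^-1` `]0, 1[ = `]0, k.+1%:R[%classic.
  by apply/seteqP; split => t; rewrite /= !in_itv/= subr_gt0 ltrBlDr ltrDl
    ltr_pdivrMr// mul1r pmulr_lgt0 ?invr_gt0// andbC.
rewrite muleA -EFinM -ge0_integralZl//=; last 2 first.
- apply/measurable_EFinP/measurable_funTS.
  apply: (@measurableT_comp _ _ _ _ _ _ (Beta_weight (1 + k.+1%:R) b)).
    exact: measurable_Beta_weight.
  by apply: measurable_funB => //; exact: measurable_funM.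
- by move=> x _; rewrite lee_fin Beta_weight_ge0.
apply: eq_integral => t; rewrite inE/= in_itv/= => /andP[t0 tk].
congr EFin; rewrite /Beta_weight addrAC subrr add0r subKr powR_mulrn; last first.
  by rewrite subr_ge0 ler_pdivrMr// mul1r ltW.
have kV : k.+1%:R^-1 `^ (b - 1) = (k.+1%:R `^ (b - 1))^-1 :> R.
  by rewrite -(powR_inv1 (ltW k0)) -powRrM mulN1r powRN.
rewrite powRM ?invr_ge0 ?(ltW t0)// kV -(mulr_powRB1 (ltW k0) b0).
(* The powers of [k.+1] cancel: [b] from the prefactor, [-1] from the Jacobian, [1 - b] from
   [(t / k.+1)^(b-1)]. *)
by field; rewrite !gt_eqF ?powR_gt0.
Qed.

(** Dominated convergence applied to [Beta_fun_rescale], the Gamma integrand being both the limit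
    and the dominating function. *)
Lemma cvg_Beta_fun_Gamma b : 0 < b ->
  k%:R `^ b * Beta_fun (1 + k%:R) b @[k --> \oo] --> Gamma b.
Proof.
move=> b0; rewrite -cvg_shiftS.
suff : (k.+1%:R `^ b * Beta_fun (1 + k.+1%:R) b)%:E @[k --> \oo] --> (Gamma b)%:E.
  exact: fine_cvg.
(* Extension by 0 past [k.+1] puts all the integrands on one half-line. *)
pose f_ k t := ((fun t => t `^ (b - 1) * (1 - t / k.+1%:R) ^+ k.+1) \_ `]0, k.+1%:R[) t.
have mf k : measurable_fun setT (f_ k).
  apply/measurable_restrict => //; apply: measurable_funTS.
  apply: measurable_funM; first exact: measurable_powR.
  apply: measurable_funX; apply: measurable_funB => //.
  exact: measurable_funM.
have H : (\int[mu]_(t in `]0%R, +oo[) (f_ k t)%:E)%E @[k --> \oo] --> (Gamma b)%:E.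
  rewrite -EFin_Gamma//.
  have mD : measurable (`]0, +oo[%classic : set R) by exact: measurable_itv.
  case: (@dominated_convergence _ _ _ mu _ mD
    (fun k t => (f_ k t)%:E) (EFin \o gamma_fun b) (EFin \o gamma_fun b))
    => [|||||_ _ //].
  - by move=> k; apply/measurable_EFinP/measurable_funTS; exact: mf.
  - by apply/measurable_EFinP/measurable_funTS; exact: measurable_gamma_fun.
  - apply: aeW => t/=; rewrite in_itv/= andbT => t0; apply/fine_cvgP.
    split; first exact: nearW.
    have H := cvg_onemX_expR t0; rewrite -cvg_shiftS in H.
    have : t `^ (b - 1) * (1 - t / k.+1%:R) ^+ k.+1 @[k --> \oo] --> gamma_fun b t.
      by apply: cvgM => //; exact: cvg_cst.
    (* For fixed [t] the truncation is invisible once [k.+1] exceeds [t]. *)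
    apply: cvg_trans; apply: near_eq_cvg; exists (Num.truncn t).+1 => // k /= tk.
    rewrite /f_ patchE mem_set//= in_itv/= t0/= (lt_le_trans (truncnS_gt t))//.
    by rewrite ler_nat (leq_trans tk).
  - exact: integrable_Gamma_integrand.
  - apply: aeW => t/= k; rewrite in_itv/= andbT => t0; rewrite lee_fin /f_ patchE.
    case: ifPn => [|_]; last by rewrite normr0.
    rewrite inE/= in_itv/= => /andP[_ tk].
    rewrite ger0_norm ?mulr_ge0 ?powR_ge0 ?exprn_ge0//; last first.
      by rewrite subr_ge0 ler_pdivrMr// mul1r ltW.
    rewrite ler_wpM2l ?powR_ge0//.
    by have /andP[] := @expR_le_onemX k.+1 t (introT andP (conj (ltW t0) tk)).
apply: cvg_trans H; apply: near_eq_cvg; apply: nearW => k.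
rewrite Beta_fun_rescale//.
rewrite [LHS]integral_mkcond [RHS]integral_mkcond; apply: eq_integral => t _.
rewrite !patchE /f_ patchE.
have [tk|_] := boolP (t \in (`]0, k.+1%:R[%classic : set R)); last by case: ifP.
rewrite (_ : (t \in _) = true)//.
by apply/mem_set; move/set_mem: tk; rewrite /= !in_itv/= andbT => /andP[].
Qed.

End gamma.

(** * Laws with a power edge at 1 *)

(** With [s = - ln q], one Taylor term of [exp(k s)] gives [q^k <= (N+1)! / (k s)^(N+1)]. As
    [N + 1 > b], what remains is a negative power of [k]. *)
Lemma cvg_powR_geometric (R : realType) (b q : R) : 0 < q < 1 ->
  k%:R `^ b * q ^+ k @[k --> \oo] --> 0.
Proof.
move=> /andP[q0 q1]; pose N := Num.truncn b; pose s := - ln q.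
have s0 : 0 < s by rewrite oppr_gt0 ln_lt0// q0.
pose C : R := N.+1`!%:R / s ^+ N.+1.
have bN : 0 < N.+1%:R - b by rewrite subr_gt0 truncnS_gt.
apply: (@squeeze_cvgr _ _ _ _ (cst 0) (fun k => C * k%:R `^ (- (N.+1%:R - b)))).
- exists 1 => // k /= k1; rewrite mulr_ge0 ?powR_ge0 ?exprn_ge0 ?(ltW q0)//=.
  have k0 : 0 < k%:R :> R by rewrite ltr0n.
  have ks : 0 <= k%:R * s by rewrite mulr_ge0// ltW.
  rewrite opprB powRB; last by rewrite (gt_eqF k0) implybT.
  rewrite mulrCA ler_wpM2l ?powR_ge0// powR_mulrn ?ler0n//.
  rewrite -(@lnK _ q) ?posrE// -expRM_natl -[ln q]opprK -/s mulrN expRN.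
  rewrite -[leRHS]invrK lef_pV2 ?posrE ?expR_gt0//; last first.
    by rewrite invr_gt0 divr_gt0 ?exprn_gt0// divr_gt0 ?exprn_gt0// ltr0n fact_gt0.
  have := expR_ge1Dxn N ks; apply: le_trans; rewrite ler_wpDl//.
  by rewrite /C invf_div invf_div exprMn mulrA.
- exact: cvg_cst.
- rewrite -[X in _ --> X](mulr0 C); apply: cvgM; first exact: cvg_cst.
  exact: cvg_powRN.
Qed.

(** * Moments as integrals against the density *)

Section edge_law.
Context (R : realType) (G : probability (measurableTypeR R) R) (g : R -> R).
Hypothesis (G01 : G `[0, 1]%classic = 1%E) (Gg : has_density G g).
Local Notation mu := (@lebesgue_measure R).

Let mg : measurable_fun setT g. Proof. by have [] := Gg. Qed.
Let g0 x : 0 <= g x. Proof. by have [_ + _] := Gg; apply. Qed.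

Let I01 : set R := `]0, 1[%classic.
Let mI : measurable I01. Proof. exact: measurable_itv. Qed.

Let GI1 : G I01 = 1%E.
Proof.
have [_ _ GE] := Gg; rewrite -G01 (GE _ mI) (GE _ (measurable_itv _)).
apply/esym/(@integral_itv_bndoo _ 0 1 (EFin \o g) true false).
exact/measurable_EFinP/measurable_funTS.
Qed.

Let GC0 : G (~` I01) = 0%E.
Proof. by rewrite probability_setC ?GI1 ?subee. Qed.

(** [G] is carried by []0, 1[], so the expectation over the line reduces to that interval almost
    everywhere; there [x^k] is nonnegative, as [ge0_integral_density] requires. *)
Lemma EFin_moment k :
  ('E_G[(fun x : R => x ^+ k)%R] = \int[mu]_(x in I01) (x ^+ k * g x)%:E)%E.
Proof.
rewrite unlock.
transitivity (\int[G]_(x in I01) (x ^+ k)%:E)%E; last first.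
  rewrite (ge0_integral_density Gg)//.
    by apply/measurable_EFinP/measurable_funTS; exact: measurable_funX.
  by move=> x; rewrite /I01/= in_itv/= => /andP[x0 _]; rewrite lee_fin exprn_ge0// ltW.
rewrite [RHS]integral_mkcond; apply: ae_eq_integral => //.
- by apply/measurable_EFinP; exact: measurable_funX.
- apply/measurable_restrict => //; rewrite setTI.
  by apply/measurable_EFinP/measurable_funTS; exact: measurable_funX.
- exists (~` I01); split => //; first exact: measurableC.
  move=> x /= h xI; apply: h => _; by rewrite patchE mem_set.
Qed.

End edge_law.

(** * Asymptotics of the moments and of the posterior *)

Section edge_law_asymptotics.
Context (R : realType) (G : probability (measurableTypeR R) R) (g : R -> R).
Hypothesis (G01 : G `[0, 1]%classic = 1%E) (Gg : has_density G g).
Local Notation mu := (@lebesgue_measure R).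

Let mg : measurable_fun setT g. Proof. by have [] := Gg. Qed.
Let g0 x : 0 <= g x. Proof. by have [_ + _] := Gg; apply. Qed.

Let I01 : set R := `]0, 1[%classic.
Let mI : measurable I01. Proof. exact: measurable_itv. Qed.

Let ig : mu.-integrable I01 (EFin \o g).
Proof.
have [_ _ GE] := Gg.
apply: (integrableS measurableT) => //.
apply/integrableP; split; first exact/measurable_EFinP.
under eq_integral do rewrite /= ger0_norm//.
by rewrite -GE// probability_setT ltry.
Qed.

Let measurable_Xg k : measurable_fun I01 (fun x => x ^+ k * g x).
Proof. by apply/measurable_funTS/measurable_funM => //; exact: measurable_funX. Qed.

Let iXg k : mu.-integrable I01 (EFin \o (fun x => x ^+ k * g x)).
Proof.
apply: le_integrable ig => //; first by apply/measurable_EFinP; exact: measurable_Xg.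
move=> x; rewrite /I01/= in_itv/= => /andP[x0 x1].
rewrite lee_fin !ger0_norm ?mulr_ge0 ?exprn_ge0 ?(ltW x0)//.
by rewrite ler_piMl// exprn_ile1// ltW.
Qed.

Lemma moment_density k : moment G k = \int[mu]_(x in `]0, 1[) (x ^+ k * g x).
Proof. by rewrite /moment (EFin_moment G01 Gg). Qed.

Lemma moment_ge0 k : 0 <= moment G k.
Proof.
rewrite moment_density; apply: Rintegral_ge0 => x.
by rewrite /= in_itv/= => /andP[x0 _]; rewrite mulr_ge0// exprn_ge0// ltW.
Qed.

Context (b c : R) (b0 : 0 < b) (c0 : 0 < c).
Hypothesis gb : asymp_equiv (1 : R)^'- g (fun x => c * (1 - x) `^ (b - 1)).

Let BwE k x : 0 < x -> Beta_weight (1 + k%:R) b x = x ^+ k * (1 - x) `^ (b - 1).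
Proof. by move=> x0; rewrite /Beta_weight addrAC subrr add0r powR_mulrn// ltW. Qed.

Let near_edge e : 0 < e -> exists q, 0 < q < 1 /\
  forall x, q < x < 1 ->
    `|g x - c * (1 - x) `^ (b - 1)| <= e * (c * (1 - x) `^ (b - 1)).
Proof.
move=> e0; have /cvgrPdist_le/(_ _ e0) := gb.
(* The maximum with 1/2 keeps [q] positive even when the radius [d] is 1 or more. *)
move=> [d /= d0 H]; exists (Num.max 2^-1 (1 - d)); split.
  by rewrite lt_max gt_max; apply/andP; split; [apply/orP; left|apply/andP; split]; lra.
move=> x; rewrite gt_max => /andP[/andP[x2 xd] x1].
have /= := H x; rewrite ger0_norm ?subr_ge0 ?(ltW x1)// => /(_ _ x1).
have w0 : 0 < c * (1 - x) `^ (b - 1) by rewrite mulr_gt0// powR_gt0 ?subr_gt0.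
have -> : 1 - g x / (c * (1 - x) `^ (b - 1)) =
  - (g x - c * (1 - x) `^ (b - 1)) / (c * (1 - x) `^ (b - 1)).
  by rewrite opprB mulrBl divff// gt_eqF.
rewrite normrM normrN normfV (gtr0_norm w0) ler_pdivrMr//; apply.
by rewrite ltrBlDl -ltrBlDr.
Qed.

(** The two error terms come from the two sides of [q]. Since both are nonnegative, their sum bounds
    the integrand on all of []0, 1[] and the integral need not be split. *)
Lemma moment_Beta_fun_dist e : 0 < e -> exists q C, 0 < q < 1 /\ forall k,
  `|moment G k - c * Beta_fun (1 + k%:R) b| <=
    e * (c * Beta_fun (1 + k%:R) b) + C * q ^+ k.
Proof.
move=> e0; have [q [q01 H]] := near_edge e0.
(* Left of [q] the difference is bounded crudely by the sum of [g] and the model density, whose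
   integral does not depend on [k]. *)
pose C := \int[mu]_(x in I01) (g x + c * Beta_weight 1 b x).
exists q, C; split => // k.
have k0 : 0 < 1 + k%:R :> R by rewrite ltr_wpDr.
have i1 := integrable_Beta_weight k0 b0.
have i2 := integrable_Beta_weight (@ltr01 R) b0.
have i3 : mu.-integrable I01 (EFin \o (fun x => g x + c * Beta_weight 1 b x)).
  by apply: integrableD_EFin => //; exact: integrableZl_EFin.
have i4 : mu.-integrable I01 (EFin \o (fun x => c * Beta_weight (1 + k%:R) b x)).
  exact: integrableZl_EFin.
have i5 : mu.-integrable I01
    (EFin \o (fun x => x ^+ k * g x - c * Beta_weight (1 + k%:R) b x)).
  exact: integrableB_EFin.
rewrite moment_density /Beta_fun.
rewrite -/I01 -!RintegralZl//.
rewrite -RintegralB// (mulrC C) -RintegralZl//.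
rewrite -RintegralD//; [|exact: integrableZl_EFin..].
apply: (le_trans (le_normr_Rintegral _ _)) => //.
apply: le_Rintegral => //.
- exact: integrable_norm.
- by apply: integrableD_EFin => //; exact: integrableZl_EFin.
move=> x; rewrite /I01/= in_itv/= => /andP[x0 x1].
have -> : Beta_weight 1 b x = (1 - x) `^ (b - 1) by rewrite -[1 in LHS](addr0) (BwE 0)// mul1r.
rewrite BwE//; set w := (1 - x) `^ (b - 1).
have w0 : 0 <= c * w by rewrite mulr_ge0 ?powR_ge0 ?ltW.
have xk : 0 <= x ^+ k by rewrite exprn_ge0// ltW.
rewrite (mulrCA c) -mulrBr normrM (ger0_norm xk).
have [xq|qx] := leP x q.
  rewrite [leLHS](_ : _ = x ^+ k * `|g x - c * w|)//.
  apply: (@le_trans _ _ (q ^+ k * (g x + c * w))); last first.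
    by rewrite lerDr; apply: mulr_ge0; [exact: ltW|exact: mulr_ge0].
  apply: ler_pM => //.
    by apply: lerXn2r => //; rewrite nnegrE ltW//; case/andP: q01.
  by rewrite (le_trans (ler_normB _ _))// !ger0_norm.
have q0 : 0 <= q by case/andP: q01 => /ltW.
rewrite ler_wpDr ?mulr_ge0 ?exprn_ge0 ?addr_ge0//.
have := H x; rewrite qx x1 -/w => /(_ isT) h.
by have := ler_wpM2l xk h; rewrite !(mulrCA e) !(mulrCA c).
Qed.

Let B k : R := Beta_fun (1 + k%:R) b.

Let B_gt0 k : 0 < B k. Proof. by rewrite Beta_fun_gt0// ltr_wpDr. Qed.

(** [B k] decays only like [k^(-b)], so multiplying numerator and denominator by [k^b] reduces this
    to [cvg_powR_geometric]. *)
Let cvg_geometric_B q : 0 < q < 1 -> q ^+ k / (c * B k) @[k --> \oo] --> 0.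
Proof.
move=> q01.
have : (k%:R `^ b * q ^+ k) / (c * (k%:R `^ b * B k)) @[k --> \oo] -->
    0 / (c * Gamma b).
  apply: cvgM; first exact: cvg_powR_geometric.
  apply: cvgV; first by rewrite mulf_neq0// gt_eqF// Gamma_gt0.
  by apply: cvgM; [exact: cvg_cst|exact: cvg_Beta_fun_Gamma].
rewrite mul0r; apply: cvg_trans; apply: near_eq_cvg; exists 1 => // k /= k1.
have kb : 0 < k%:R `^ b :> R by rewrite powR_gt0// ltr0n.
by field; rewrite !gt_eqF//.
Qed.

(** [moment_Beta_fun_dist] at [e / 2], divided by [c * B k]: the geometric term takes up the other
    half of [e] for large [k]. *)
Lemma cvg_moment_Beta_fun : moment G k / (c * B k) @[k --> \oo] --> (1 : R).
Proof.
apply/cvgrPdist_le => e e0; have e20 : 0 < e / 2 by rewrite divr_gt0.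
have [q [C [q01 H]]] := moment_Beta_fun_dist e20.
have : C * (q ^+ k / (c * B k)) @[k --> \oo] --> C * 0.
  by apply: cvgM; [exact: cvg_cst|exact: cvg_geometric_B].
rewrite mulr0 => /cvgrPdist_le/(_ _ e20)[N _ HN]; exists N => // k /HN /=.
rewrite sub0r normrN => /(le_trans (ler_norm _)) h.
have cB : 0 < c * B k by rewrite mulr_gt0.
have -> : 1 - moment G k / (c * B k) = - (moment G k - c * B k) / (c * B k).
  by field; rewrite !gt_eqF.
rewrite normrM normrN normfV (gtr0_norm cB) ler_pdivrMr//.
apply: (le_trans (H k)); rewrite -/(B k).
have -> : C * q ^+ k = C * (q ^+ k / (c * B k)) * (c * B k).
  by field; rewrite !gt_eqF.
by rewrite -mulrDl; apply: ler_wpM2r; [exact: ltW|lra].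
Qed.

Lemma moment_asymp : asymp_equiv \oo (fun k : nat => moment G k)
  (fun k : nat => c * Gamma b * k%:R `^ (- b)).
Proof.
have Gb := Gamma_gt0 b0.
have : moment G k / (c * B k) * (k%:R `^ b * B k / Gamma b) @[k --> \oo] -->
    1 * (Gamma b / Gamma b).
  apply: cvgM; first exact: cvg_moment_Beta_fun.
  by apply: cvgM; [exact: cvg_Beta_fun_Gamma|exact: cvg_cst].
rewrite mul1r divff ?gt_eqF//; apply: cvg_trans; apply: near_eq_cvg.
(* [B k] cancels, and [k^b] stands on both sides, so [k = 0] is no exception. *)
apply: nearW => k; rewrite powRN !invfM invrK.
by field; rewrite !gt_eqF.
Qed.

Lemma cvg_moment0 : moment G k @[k --> \oo] --> 0.
Proof.
have : moment G k / (c * Gamma b * k%:R `^ (- b)) * (c * Gamma b * k%:R `^ (- b))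
    @[k --> \oo] --> 1 * (c * Gamma b * 0).
  apply: cvgM; first exact: moment_asymp.
  by apply: cvgM; [exact: cvg_cst|exact: cvg_powRN].
(* [k = 0] is excluded because [0] to the power [- b] is [0] by convention. *)
rewrite mulr0 mul1r; apply: cvg_trans; apply: near_eq_cvg; exists 1 => // k /= k1.
by rewrite divfK// !mulf_neq0// gt_eqF ?Gamma_gt0// powR_gt0// ltr0n.
Qed.

(** Since [1 - r_k = (1 - p0) m_k / (p0 + (1 - p0) m_k)], the ratio to be studied is that of
    [moment_asymp] times [p0 / (p0 + (1 - p0) m_k)], which tends to 1 by [cvg_moment0]. *)
Lemma posterior_asymp (p0 : R) : 0 < p0 < 1 ->
  asymp_equiv \oo (fun k : nat => 1 - posterior p0 G k)
    (fun k : nat => (1 - p0) / p0 * (c * Gamma b) * k%:R `^ (- b)).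
Proof.
move=> /andP[p00 p01]; have Gb := Gamma_gt0 b0.
have q0 : 0 < 1 - p0 by rewrite subr_gt0.
have : moment G k / (c * Gamma b * k%:R `^ (- b)) *
    (p0 / (p0 + (1 - p0) * moment G k)) @[k --> \oo] --> 1 * (p0 / (p0 + (1 - p0) * 0)).
  apply: cvgM; first exact: moment_asymp.
  apply: cvgM; first exact: cvg_cst.
  apply: cvgV; first by rewrite mulr0 addr0 gt_eqF.
  apply: cvgD; first exact: cvg_cst.
  by apply: cvgM; [exact: cvg_cst|exact: cvg_moment0].
rewrite mulr0 addr0 divff ?gt_eqF// mul1r; apply: cvg_trans; apply: near_eq_cvg.
apply: nearW => k; rewrite /posterior powRN !invfM !invrK.
have d0 : 0 < p0 + (1 - p0) * moment G k.
  by rewrite ltr_wpDr// mulr_ge0 ?moment_ge0// ltW.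
by field; rewrite !gt_eqF.
Qed.

End edge_law_asymptotics.

(** * The Beta law *)

Section beta_law.
Context (R : realType) (a b : R) (a0 : 0 < a) (b0 : 0 < b).
Local Notation mu := (@lebesgue_measure R).

Lemma has_density_Beta_prob : has_density (Beta_prob a0 b0) (Beta_pdf a b).
Proof.
split; [exact: measurable_Beta_pdf|exact: Beta_pdf_ge0|by []].
Qed.

Lemma Beta_prob_itv01 : Beta_prob a0 b0 `[0, 1]%classic = 1%E.
Proof.
rewrite /Beta_prob -(integral_Beta_pdf a0 b0) integral_mkcond.
apply: eq_integral => x _; rewrite patchE; case: ifPn => // xI.
rewrite /Beta_pdf patchE ifF//; apply: contraNF xI.
by rewrite !inE/=; exact: subset_itv_oo_cc.
Qed.

Lemma moment_Beta_prob k :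
  moment (Beta_prob a0 b0) k = Beta_fun (a + k%:R) b / Beta_fun a b.
Proof.
rewrite (moment_density Beta_prob_itv01 has_density_Beta_prob).
have ak : 0 < a + k%:R by rewrite ltr_wpDr.
rewrite [RHS]mulrC {2}/Beta_fun -RintegralZl//; last exact: integrable_Beta_weight.
apply: eq_Rintegral => x xI; rewrite /Beta_pdf patchE xI.
move/set_mem: xI; rewrite /= in_itv/= => /andP[x0 x1].
rewrite /Beta_weight [a + k%:R - 1]addrAC (@powRD _ x (a - 1)); last by rewrite (gt_eqF x0) implybT.
by rewrite powR_mulrn ?(ltW x0)//; ring.
Qed.

(** On []0, 1[] the density divided by its edge model is exactly [x^(a-1)], which is continuous at 1
    with value 1. *)
Lemma power_edge_law_Beta_prob :
  power_edge_law (Beta_prob a0 b0) (Beta_pdf a b) b (Beta_fun a b)^-1.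
Proof.
have B0 := Beta_fun_gt0 a0 b0.
split; [exact: Beta_prob_itv01| |exact: has_density_Beta_prob|].
  exact: (integral_set1 (EFin \o Beta_pdf a b)).
have c1 : x `^ (a - 1) @[x --> (1 : R)^'-] --> (1 : R).
  have := @continuous_powR R (a - 1) 1 ltr01.
  by rewrite /prop_for /continuous_at powR1 => /cvg_at_left_filter.
apply: cvg_trans c1; apply: near_eq_cvg; near=> x.
have x0 : 0 < x by near: x; exact: nbhs_left_gt.
have x1 : x < 1 by near: x; exact: nbhs_left_lt.
rewrite /Beta_pdf patchE mem_set; last by rewrite /= in_itv/= x0.
have w0 : 0 < (1 - x) `^ (b - 1) by rewrite powR_gt0// subr_gt0.
by rewrite /Beta_weight; field; rewrite !gt_eqF.
Unshelve. all: by end_near. Qed.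

End beta_law.

(* Both sides are limits of
   [k `^ b * Beta_fun (1 + k) (a + b) / Beta_fun (1 + k) a]: the right-hand one
   by [cvg_Beta_fun_Gamma], the left-hand one because this ratio is, up to a
   constant, the [k]-th moment of the Beta(1 + a, b) law times [k `^ b]. *)
Lemma Gamma_ratio (R : realType) (a b : R) : 0 < a -> 0 < b ->
  (Beta_fun a b)^-1 * Gamma b = Gamma (a + b) / Gamma a.
Proof.
move=> a0 b0; have ab0 : 0 < a + b by rewrite addr_gt0.
have a1 : 0 < 1 + a by rewrite addr_gt0.
have ab1 : 0 < 1 + a + b by rewrite addr_gt0.
have [Ga Gb Gab] := And3 (Gamma_gt0 a0) (Gamma_gt0 b0) (Gamma_gt0 ab0).
pose u k : R := k%:R `^ b * Beta_fun (1 + k%:R) (a + b) / Beta_fun (1 + k%:R) a.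
have Bp k (s : R) : 0 < s -> 0 < Beta_fun (1 + k%:R) s.
  by move=> s0; rewrite Beta_fun_gt0// ltr_wpDr.
have c1 : u k @[k --> \oo] --> Gamma (a + b) / Gamma a.
  have : k%:R `^ (a + b) * Beta_fun (1 + k%:R) (a + b) /
      (k%:R `^ a * Beta_fun (1 + k%:R) a) @[k --> \oo] --> Gamma (a + b) / Gamma a.
    apply: cvgM; first exact: cvg_Beta_fun_Gamma.
    by apply: cvgV; [rewrite gt_eqF|exact: cvg_Beta_fun_Gamma].
  apply: cvg_trans; apply: near_eq_cvg; exists 1 => // k /= k1.
  have ka : 0 < k%:R `^ a :> R by rewrite powR_gt0// ltr0n.
  rewrite /u powRD; last by rewrite pnatr_eq0 -lt0n k1 implybT.
  by field; rewrite !gt_eqF// Bp.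
have c2 : u k @[k --> \oo] --> (Beta_fun a b)^-1 * Gamma b.
  have [_ _ _ ae] := power_edge_law_Beta_prob a1 b0.
  have Ba := Beta_fun_gt0 a1 b0; have Ba0 := Beta_fun_gt0 a0 b0.
  have iB : 0 < (Beta_fun (1 + a) b)^-1 by rewrite invr_gt0.
  (* As [B(1+k, s) = (1)_k / (s (1+s)_k)], the ratio in [u k] is [a / (a + b)] times
     [(1+a)_k / (1+a+b)_k]; hence this constant and the first parameter [1 + a]. *)
  have : a / (a + b) * ((Beta_fun (1 + a) b)^-1 * Gamma b) *
     (moment (Beta_prob a1 b0) k /
      ((Beta_fun (1 + a) b)^-1 * Gamma b * k%:R `^ (- b))) @[k --> \oo] -->
     a / (a + b) * ((Beta_fun (1 + a) b)^-1 * Gamma b) * 1.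
    apply: cvgM; first exact: cvg_cst.
    exact: (moment_asymp (Beta_prob_itv01 a1 b0) (has_density_Beta_prob a1 b0) b0 iB ae).
  (* The recursion [Beta_funDl] absorbs [a / (a + b)] and brings [1 + a] back to [a]. *)
  have -> : a / (a + b) * ((Beta_fun (1 + a) b)^-1 * Gamma b) * 1 =
      (Beta_fun a b)^-1 * Gamma b.
    have H := Beta_funDl a0 b0.
    have -> : Beta_fun (1 + a) b = a * Beta_fun a b / (a + b).
      by rewrite -H addrC mulrAC divff ?mul1r// gt_eqF.
    by field; rewrite !gt_eqF.
  apply: cvg_trans; apply: near_eq_cvg; apply: nearW => k.
  rewrite moment_Beta_prob (Beta_funDn _ a1 b0) /u.
  rewrite (Beta_funDn _ ltr01 ab0) (Beta_funDn _ ltr01 a0) !Beta_fun1//.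
  rewrite powRN addrA.
  have r0 (s : R) : 0 < s -> 0 < rising_fact s k.
    by move=> s0; apply: prodr_gt0 => i _; rewrite ltr_wpDr.
  have [r1 r2 r3] := And3 (r0 _ ltr01) (r0 _ a1) (r0 _ ab1).
  rewrite !invfM !invrK.
  by field; rewrite !gt_eqF.
by rewrite (cvg_unique _ c1 c2).
Qed.

Theorem theorem3p5 (R : realType) :
  (forall (p0 : R) (G : probability (measurableTypeR R) R) (g : R -> R)
      (b c : R),
    0 < p0 < 1 -> 0 < b -> 0 < c -> power_edge_law G g b c ->
    let kappa := (1 - p0) / p0 * (c * Gamma b) in
    asymp_equiv \oo (fun k : nat => moment G k)
      (fun k : nat => c * Gamma b * k%:R `^ (- b)) /\
    asymp_equiv \oo (fun k : nat => 1 - posterior p0 G k)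
      (fun k : nat => kappa * k%:R `^ (- b)))
  /\
  (forall (a b : R) (a0 : 0 < a) (b0 : 0 < b),
    (forall k : nat,
      moment (Beta_prob a0 b0) k = rising_fact a k / rising_fact (a + b) k /\
      moment (Beta_prob a0 b0) k =
        \prod_(j < k) ((a + j%:R) / (a + b + j%:R))) /\
    exists c : R,
      [/\ 0 < c,
          power_edge_law (Beta_prob a0 b0) (Beta_pdf a b) b c &
          c * Gamma b = Gamma (a + b) / Gamma a]).
Proof.
split=> [p0 G g b c p01 b0 c0 [G01 _ Gg gb]|a b a0 b0].
  split; first exact: (moment_asymp G01 Gg).
  exact: (posterior_asymp G01 Gg).
split=> [k|].
  have mE : moment (Beta_prob a0 b0) k = rising_fact a k / rising_fact (a + b) k.
    rewrite moment_Beta_prob Beta_funDn// mulrC mulKf// gt_eqF//.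
    exact: Beta_fun_gt0.
  by split=> //; rewrite mE prodf_div.
(* The edge constant is the normalising constant of the density, because [x^(a-1)] tends to 1 at the
   edge. *)
exists (Beta_fun a b)^-1; split; last exact: Gamma_ratio.
  by rewrite invr_gt0 Beta_fun_gt0.
exact: power_edge_law_Beta_prob.
Qed.
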